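(* Fix integers $s,t\geq 1$ and $k\geq 3$. Then, as $n\to\infty$, \[ {\rm La}(n,P_k(s,t))\leq \sum_{i=\lfloor \frac{n-(k-2)}{2}\rfloor}^{\lfloor \frac{n+(k-2)}{2}\rfloor}\binom{n}{i} + \binom{n}{\lfloor \frac{n+k}{2}\rfloor}\left(\frac{2k(s+t-2)}{n}+O\!\left(n^{-3/2}\sqrt{\ln n}\right)\right). \] Consequently, ${\rm La}(n,P_k(s,t))/\binom{n}{\lfloor n/2\rfloor}\to k-1$ as $n\to\infty$.
   Context: A poset $(S,\leq)$ contains a poset $(S',\leq')$ (as a subposet) if there is an injection $f\colon S'\to S$ such that $u\leq' v$ implies $f(u)\leq f(v)$ (copies need not be induced). For a poset $H$, a family $\mathcal{F}\subseteq 2^{[n]}$ of subsets of $[n]=\{1,\dots,n\}$ is $H$-free if the poset $(\mathcal{F},\subseteq)$ does not contain $H$. ${\rm La}(n,H)$ denotes the maximum size of an $H$-free family $\mathcal{F}\subseteq 2^{[n]}$. The baton $P_k(s,t)$ ($k\geq 3$, $s,t\geq1$) is the poset obtained from a chain of $k$ elements by replicating the bottom element $s-1$ times and the top element $t-1$ times; that is, it has elements $a_1,\dots,a_s$, $c_2<c_3<\dots<c_{k-1}$, $b_1,\dots,b_t$ with $a_i<c_2$ for all $i$ and $c_{k-1}<b_j$ for all $j$ (the $a_i$ pairwise incomparable, the $b_j$ pairwise incomparable), and the order generated by these relations. The constants in the $O(\cdot)$ may depend on $k,s,t$. *)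

(* Defs.v *)
From HB Require Import structures.
From mathcomp Require Import all_boot all_order.

Set Implicit Arguments.
Unset Strict Implicit.
Unset Printing Implicit Defensive.

Import Order.TTheory.

(* A copy of Q in P need not be induced: f only has to preserve the order. *)
Definition contains (d d' : Order.disp_t)
    (P : finPOrderType d) (Q : finPOrderType d') : bool :=
  [exists f : {ffun Q -> P},
     injectiveb f && [forall u, forall v, (u <= v)%O ==> (f u <= f v)%O]].

Lemma containsP (d d' : Order.disp_t)
    (P : finPOrderType d) (Q : finPOrderType d') :
  reflect (exists f : Q -> P,
             injective f /\ (forall u v, (u <= v)%O -> (f u <= f v)%O))
          (contains P Q).
Proof.
apply: (iffP existsP) => [[f /andP[/injectiveP injf /forallP homf]]|[f [injf homf]]].
  exists f; split=> // u v uv.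
  by move/forallP: (homf u) => /(_ v)/implyP/(_ uv).
exists (finfun f); apply/andP; split.
  by apply/injectiveP => u v; rewrite !ffunE => /injf.
by apply/forallP => u; apply/forallP => v; apply/implyP => /homf; rewrite !ffunE.
Qed.

Definition family_poset (n : nat) (F : {set {set 'I_n}}) : Type :=
  {A : {set 'I_n} | A \in F}.

HB.instance Definition _ (n : nat) (F : {set {set 'I_n}}) :=
  SubFinite.on (family_poset F).

Definition family_le (n : nat) (F : {set {set 'I_n}}) : rel (family_poset F) :=
  fun A B => val A \subset val B.

Fact family_le_refl (n : nat) (F : {set {set 'I_n}}) : reflexive (@family_le n F).
Proof. by move=> A; exact: subxx. Qed.

Fact family_le_anti (n : nat) (F : {set {set 'I_n}}) :
  antisymmetric (@family_le n F).
Proof. by move=> A B AB; apply/val_inj/eqP; rewrite eqEsubset. Qed.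

Fact family_le_trans (n : nat) (F : {set {set 'I_n}}) : transitive (@family_le n F).
Proof. by move=> B A C; exact: subset_trans. Qed.

HB.instance Definition _ (n : nat) (F : {set {set 'I_n}}) :=
  Order.Le_isPOrder.Build Order.SetSubsetOrder.subset_display (family_poset F)
    (@family_le_refl n F) (@family_le_anti n F) (@family_le_trans n F).

Definition poset_free (d : Order.disp_t) (H : finPOrderType d)
    (n : nat) (F : {set {set 'I_n}}) : bool :=
  ~~ contains (family_poset F) H.

Definition La (d : Order.disp_t) (n : nat) (H : finPOrderType d) : nat :=
  \max_(F : {set {set 'I_n}} | poset_free H F) #|F|.

(* inl (inl i) is a_(i+1), inl (inr i) is c_(i+2), and inr j is b_(j+1). *)
Definition baton (k s t : nat) : Type := ('I_s + 'I_(k - 2) + 'I_t)%type.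

HB.instance Definition _ (k s t : nat) := Finite.on (baton k s t).

(* The generating relations a_i < c_2, c_i < c_(i+1), c_(k-1) < b_j. *)
Definition baton_gen (k s t : nat) : rel (baton k s t) := fun x y =>
  match x, y with
  | inl (inl _), inl (inr c) => c == 0 :> nat
  | inl (inr c), inl (inr c') => c' == c.+1 :> nat
  | inl (inr c), inr _ => c.+1 == k - 2
  | _, _ => false
  end.

Definition baton_le (k s t : nat) : rel (baton k s t) := connect (@baton_gen k s t).

Definition baton_rank (k s t : nat) (x : baton k s t) : nat :=
  match x with
  | inl (inl _) => 0
  | inl (inr c) => c.+1
  | inr _ => k.+1
  end.

Lemma baton_gen_rank (k s t : nat) (x y : baton k s t) :
  baton_gen x y -> baton_rank x < baton_rank y.
Proof.
case: x => [[i|c]|j]; case: y => [[i'|c']|j'] //=; first by move/eqP=> ->.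
by move=> _; rewrite ltnS (leq_trans (ltn_ord c)) ?leq_subr.
Qed.

Lemma baton_le_rank (k s t : nat) (x y : baton k s t) :
  baton_le x y -> x = y \/ baton_rank x < baton_rank y.
Proof.
move=> /connectP[p + ->]; elim: p x => [|z p IH] x /=; first by left.
move=> /andP[/baton_gen_rank xz /IH[<-|zl]]; first by right.
by right; apply: ltn_trans xz zl.
Qed.

Fact baton_le_refl (k s t : nat) : reflexive (@baton_le k s t).
Proof. by move=> x; exact: connect0. Qed.

Fact baton_le_anti (k s t : nat) : antisymmetric (@baton_le k s t).
Proof.
move=> x y /andP[/baton_le_rank[//|xy] /baton_le_rank[//|yx]].
by have := ltn_trans xy yx; rewrite ltnn.
Qed.

Fact baton_le_trans (k s t : nat) : transitive (@baton_le k s t).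
Proof. by move=> y x z; exact: connect_trans. Qed.

Fact baton_display : Order.disp_t. Proof. exact: Order.Disp tt tt. Qed.

HB.instance Definition _ (k s t : nat) :=
  Order.Le_isPOrder.Build baton_display (baton k s t)
    (@baton_le_refl k s t) (@baton_le_anti k s t) (@baton_le_trans k s t).

Lemma le_family_posetE (n : nat) (F : {set {set 'I_n}}) (A B : family_poset F) :
  (A <= B)%O = (val A \subset val B).
Proof. by []. Qed.

Lemma le_batonE (k s t : nat) (x y : baton k s t) :
  (x <= y)%O = connect (@baton_gen k s t) x y.
Proof. by []. Qed.

(* Main.v *)
(* Averaging over maximal chains shows that a family in which each member has
   at most r other members below it, all of size at least m, has Lubell weight
   at most m / (m - r). A baton-free family, trimmed to sizes between n / 4 and
   3 n / 4 (the discarded sets are exponentially few), splits into the members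
   with fewer than s members below, those with fewer than t members above, and
   a remainder without chains of k - 2 sets; the weights of the three parts are
   at most 1 + O(1 / n), 1 + O(1 / n) and k - 3. A family of weight k - 1 + x
   has at most as many sets as the k - 1 largest levels plus x times the next
   largest one. *)

Require Import Defs.
From HB Require Import structures.
From mathcomp Require Import all_boot all_order all_fingroup all_algebra.
From mathcomp Require Import zify ring lra.

Set Implicit Arguments.
Unset Strict Implicit.
Unset Printing Implicit Defensive.

Import Order.TTheory GRing.Theory Num.Theory.

(** * Counting the maximal chains through one or two given sets *)

(* A permutation p of 'I_n stands for the maximal chain formed by the images
   under p of the initial segments. *)
Definition hits n (p : {perm 'I_n}) (A : {set 'I_n}) : bool :=
  p @: [set i : 'I_n | i < #|A|] == A.

Definition hitters n (A : {set 'I_n}) : {set {perm 'I_n}} := [set p | hits p A].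

Lemma card_initial n m : m <= n -> #|[set i : 'I_n | i < m]| = m.
Proof.
move=> mn; rewrite cardsE -sum1_card -(big_ord_widen n (fun=> 1) mn).
by rewrite sum1_card card_ord.
Qed.

Lemma leq_card_ord n (A : {set 'I_n}) : #|A| <= n.
Proof. by rewrite -[leqRHS]card_ord max_card. Qed.

Lemma hits_initial n (p : {perm 'I_n}) m :
  m <= n -> hits p (p @: [set i : 'I_n | i < m]).
Proof.
by move=> mn; rewrite /hits card_imset ?card_initial //; exact: perm_inj.
Qed.

Lemma hits_subset n (p : {perm 'I_n}) (A B : {set 'I_n}) :
  hits p A -> hits p B -> #|A| <= #|B| -> A \subset B.
Proof.
move=> /eqP <- /eqP <-; rewrite !card_imset; try exact: perm_inj.
rewrite !card_initial ?leq_card_ord // => AB.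
by apply/imsetS/subsetP => i; rewrite !inE => /leq_trans; apply.
Qed.

Lemma imset_permM (T : finType) (p q : {perm T}) (A : {set T}) :
  (p * q)%g @: A = q @: (p @: A).
Proof. by rewrite -imset_comp; apply: eq_imset => i; rewrite /= permM. Qed.

Lemma hits_mulr n (p q : {perm 'I_n}) (A : {set 'I_n}) :
  hits (p * q)%g (q @: A) = hits p A.
Proof.
rewrite /hits card_imset; last exact: perm_inj.
by rewrite imset_permM; apply/eqP/eqP => [|-> //]; apply: imset_inj; exact: perm_inj.
Qed.

(** Transposing some [x] in [A :\: A'] with some [y] in [A' :\: A] stabilises [B], which contains
    both points, and shrinks [A :\: A']; such transpositions are composed until [A] becomes [A']. *)
Lemma perm_moving n (A A' B : {set 'I_n}) :
  A \subset B -> A' \subset B -> #|A| = #|A'| ->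
  exists2 q : {perm 'I_n}, q @: A = A' & q @: B = B.
Proof.
move: {2}#|A :\: A'|.+1 (ltnSn #|A :\: A'|) => m.
elim: m A => // m IH A; rewrite ltnS => Am AB A'B AA'.
have [AsubA'|/subsetPn[x xA xA']] := boolP (A \subset A').
  have /eqP <- : A == A' by rewrite eqEcard AsubA' AA' /=.
  by exists 1%g; rewrite -[RHS]imset_id; apply: eq_imset => i; rewrite perm1.
have /subsetPn[y yA' yA] : ~~ (A' \subset A).
  apply: contra xA' => A'A; have /eqP -> // : A' == A.
  by rewrite eqEcard A'A AA' /=.
have xB := subsetP AB _ xA; have yB := subsetP A'B _ yA'.
pose q := tperm x y.
have qB : q @: B = B.
  apply/eqP; rewrite eqEcard card_imset ?leqnn ?andbT; last exact: perm_inj.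
  by apply/subsetP => _ /imsetP[i iB ->]; rewrite /q; case: tpermP => // ->.
have [||//||r rA rB] := IH (q @: A).
- apply: leq_trans Am; apply: proper_card; apply/properP; split; last first.
    exists x; rewrite !inE ?xA' ?xA //; apply/negP => /andP[_ /imsetP[i iA]].
    rewrite /q; case: tpermP => [_ xy | iy _ | ix _ xi].
    - by rewrite -xy xA in yA.
    - by rewrite -iy iA in yA.
    - by case: ix.
  apply/subsetP => j; rewrite !inE => /andP[jA' /imsetP[i iA ji]].
  rewrite jA' /=; move: ji; rewrite /q; case: tpermP => [_ ji|iy _| _ _ -> //].
    by rewrite ji yA' in jA'.
  by rewrite -iy iA in yA.
- by rewrite -qB imsetS.
- by rewrite card_imset //; exact: perm_inj.
by exists (q * r)%g; rewrite imset_permM ?rA ?qB.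
Qed.

(** Double counting of pairs of a chain through [B] and a subset of [B] of size [#|A|] on it: by
    symmetry all these subsets lie on equally many chains through [B], and each such chain passes
    through exactly one of them. *)
Lemma card_hitters2 n (A B : {set 'I_n}) : A \subset B ->
  #|hitters A :&: hitters B| * 'C(#|B|, #|A|) = #|hitters B|.
Proof.
move=> AB.
have eqA (A' : {set 'I_n}) : A' \subset B -> #|A'| = #|A| ->
    #|hitters A' :&: hitters B| = #|hitters A :&: hitters B|.
  move=> A'B /(perm_moving A'B AB)[q qA qB].
  (* Right multiplication by [q] is a bijection from the permutations hitting [A'] and [B] to those
     hitting [A] and [B]. *)
  rewrite -[RHS](card_preimset _ (mulIg q)); apply: eq_card => p.
  by rewrite !inE -qA -[in RHS]qB !hits_mulr.
rewrite -cards_draws mulnC -sum_nat_const.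
rewrite (eq_bigr (fun A' => #|hitters A' :&: hitters B|)); last first.
  by move=> A'; rewrite !inE => /andP[? /eqP ?]; rewrite eqA.
rewrite (eq_bigr (fun A' => \sum_(p in hitters B) (p \in hitters A' : nat))); last first.
  move=> A' _; rewrite -sum1_card big_mkcond [RHS]big_mkcond /=.
  by apply: eq_bigr => p _; rewrite in_setI andbC; do 2 case: (p \in _).
rewrite exchange_big -[RHS]sum1_card; apply: eq_bigr => p; rewrite inE => pB.
have aN : #|A| <= n := leq_card_ord A.
set A0 := p @: [set i : 'I_n | i < #|A|].
have A0p : hits p A0 by exact: hits_initial.
have cA0 : #|A0| = #|A| by rewrite card_imset ?card_initial //; exact: perm_inj.
rewrite (bigD1 A0) /=; last first.
  by rewrite !inE cA0 eqxx (hits_subset A0p pB) // cA0 subset_leq_card.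
rewrite inE A0p big1 // => A'; rewrite !inE => /andP[/andP[_ /eqP cA']].
apply: contra_neq_eq => pA'; apply/esym/eqP.
have {}pA' : hits p A' by move: pA'; case: hits.
by rewrite eqEcard (hits_subset A0p pA') cA0 cA' /=.
Qed.

Lemma card_hitters n (A : {set 'I_n}) : #|hitters A| * 'C(n, #|A|) = n`!.
Proof.
have hT : hitters [set: 'I_n] = setT.
  apply/setP => p; rewrite !inE /hits eqEcard subsetT.
  rewrite card_imset; last exact: perm_inj.
  by rewrite cardsT card_ord card_initial leqnn.
have := card_hitters2 (subsetT A); rewrite hT setIT cardsT card_ord => ->.
by rewrite cardsT -(card_Sn n); apply: eq_card => p; rewrite !inE.
Qed.

(** * The lowest member of a family on a maximal chain *)

Definition first_hitters n (L : {set {set 'I_n}}) (B : {set 'I_n}) :=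
  [set p in hitters B | [forall A in L, (A \proper B) ==> ~~ hits p A]].

(** The sets hit by one permutation are nested, so at most one member of [L] is the lowest of them,
    and the events being counted are disjoint. *)
Lemma sum_first_hitters n (L : {set {set 'I_n}}) :
  \sum_(B in L) #|first_hitters L B| <= n`!.
Proof.
rewrite -(card_Sn n) -[leqRHS]sum1_card.
rewrite (eq_bigr (fun B => \sum_(p : {perm 'I_n}) (p \in first_hitters L B : nat))); last first.
  by move=> B _; rewrite -sum1_card big_mkcond; apply: eq_bigr => p _; case: (p \in _).
rewrite exchange_big /= [leqRHS](eq_bigl xpredT); last by move=> p; rewrite !inE.
apply: leq_sum => p _.
rewrite -big_mkcondr sum1_card; apply/card_le1_eqP.
have H (A B : {set 'I_n}) : A \in L -> p \in first_hitters L A ->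
    p \in first_hitters L B -> #|A| <= #|B| -> A = B.
  rewrite !inE => AL /andP[pA _] /andP[pB /forallP/(_ A)].
  rewrite AL pA implybF properE => + AB.
  rewrite (hits_subset pA pB) //= negbK => BA.
  by apply/eqP; rewrite eqEsubset BA (hits_subset pA pB AB).
move=> A B; rewrite !unfold_in => /andP[AL pA] /andP[BL pB].
by have [AB|/ltnW AB] := leqP #|A| #|B|; [exact/esym/(H A B)|exact: (H B A)].
Qed.

Lemma leq_bin_self n m : 0 < m < n -> n <= 'C(n, m).
Proof.
case/andP; elim: n m => // n IH [//|[|m]] _ mn; first by rewrite bin1.
rewrite ltnS in mn; rewrite binS -add1n leq_add //; first by rewrite bin_gt0.
by apply: IH.
Qed.

Lemma leq_card_bigcup (I T : finType) (P : pred I) (F : I -> {set T}) :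
  #|\bigcup_(i | P i) F i| <= \sum_(i | P i) #|F i|.
Proof.
elim/big_ind2: _ => [|A a B b Aa Bb|//]; first by rewrite cards0.
by rewrite (leq_trans (leq_card_setU _ _)) // leq_add.
Qed.

(** Union bound: a chain through [B] that is not counted in [first_hitters L B] passes through one
    of at most [r] members [A] strictly below [B]. Each such [A] lies on a fraction
    [1 / 'C(#|B|, #|A|)] of the chains through [B], which is at most [1 / #|B|], hence at most
    [1 / m], because [0 < #|A| < #|B|]. *)
Lemma leq_first_hitters n m r (L : {set {set 'I_n}}) (B : {set 'I_n}) :
    0 < m -> {in L, forall A : {set 'I_n}, m <= #|A|} -> B \in L ->
    #|[set A in L | A \proper B]| <= r ->
  m * #|hitters B| <= m * #|first_hitters L B| + r * #|hitters B|.
Proof.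
move=> m0 mL BL rB; set D := [set A in L | _] in rB.
have sub : hitters B \subset
    first_hitters L B :|: \bigcup_(A in D) (hitters A :&: hitters B).
  apply/subsetP => p pB; rewrite !inE; rewrite inE in pB; rewrite pB /=.
  case: (boolP [forall A in L, _]) => //= /forallPn[A].
  rewrite 2!negb_imply negbK => /and3P[AL AB pA].
  by apply/bigcupP; exists A; rewrite !inE ?AL ?pA.
have := leq_trans (subset_leq_card sub) (leq_card_setU _ _).
rewrite -(leq_pmul2l m0) mulnDr => /leq_trans; apply; rewrite leq_add2l.
apply: (@leq_trans (\sum_(A in D) #|hitters B|)); last first.
  by rewrite sum_nat_const leq_mul2r rB orbT.
apply: leq_trans (leq_mul (leqnn m) (leq_card_bigcup _ _)) _.
rewrite big_distrr; apply: leq_sum => A; rewrite inE => /andP[AL AB] /=.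
rewrite -(card_hitters2 (proper_sub AB)) mulnC leq_mul2l; apply/orP; right.
apply: leq_trans (mL _ BL) (leq_bin_self _).
by rewrite (leq_trans m0 (mL _ AL)) proper_card.
Qed.

(** * Bounds on the Lubell weight *)

(** This is the expected number of members of [F] on a uniformly random maximal chain. *)
Definition lubell (R : realFieldType) n (F : {set {set 'I_n}}) : R :=
  (\sum_(A in F) ('C(n, #|A|))%:R^-1)%R.

Lemma bin_card_gt0 n (A : {set 'I_n}) : 0 < 'C(n, #|A|).
Proof. by rewrite bin_gt0 leq_card_ord. Qed.

(* The events "B is the lowest member of L on a random maximal chain" are
   disjoint, and each has probability at least (1 - r / m) / 'C(n, #|B|). *)
Lemma lubell_few_below (R : realFieldType) n m r (L : {set {set 'I_n}}) :
    0 < m -> {in L, forall A : {set 'I_n}, m <= #|A|} ->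
    {in L, forall B : {set 'I_n}, #|[set A in L | A \proper B]| <= r} ->
  ((m%:R - r%:R) * lubell R L <= m%:R)%R.
Proof.
move=> m0 mL rL.
have H : m * (\sum_(B in L) #|hitters B|) <=
    m * n`! + r * (\sum_(B in L) #|hitters B|).
  apply: (@leq_trans (m * (\sum_(B in L) #|first_hitters L B|)
                      + r * (\sum_(B in L) #|hitters B|))).
    rewrite !big_distrr -big_split /=.
    by apply: leq_sum => B BL; apply: leq_first_hitters (rL B BL).
  by rewrite leq_add2r leq_mul2l sum_first_hitters orbT.
have E : ((\sum_(B in L) #|hitters B|)%:R = n`!%:R * lubell R L)%R.
  rewrite natr_sum /lubell big_distrr; apply: eq_bigr => B _ /=.
  rewrite -(card_hitters B) natrM mulfK // pnatr_eq0 -lt0n.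
  exact: bin_card_gt0.
move: H; rewrite -(ler_nat R) natrD !natrM E => H.
rewrite -(@ler_pM2l R n`!%:R); last by rewrite ltr0n fact_gt0.
by lra.
Qed.

Lemma lubell_setC (R : realFieldType) n (F : {set {set 'I_n}}) :
  lubell R (@setC _ @: F) = lubell R F.
Proof.
rewrite /lubell big_imset /=; last by move=> ? ? _ _ /setC_inj.
apply: eq_bigr => A _; rewrite cardsCs setCK card_ord bin_sub //.
exact: leq_card_ord.
Qed.

(** Complementation reverses inclusion and preserves the weight, which reduces this to
    [lubell_few_below]. *)
Lemma lubell_few_above (R : realFieldType) n m r (L : {set {set 'I_n}}) :
    0 < m -> {in L, forall A : {set 'I_n}, #|A| + m <= n} ->
    {in L, forall B : {set 'I_n}, #|[set A in L | B \proper A]| <= r} ->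
  ((m%:R - r%:R) * lubell R L <= m%:R)%R.
Proof.
move=> m0 mL rL; rewrite -lubell_setC; apply: lubell_few_below => //.
  move=> _ /imsetP[A AL ->]; rewrite cardsCs setCK card_ord.
  by have := mL _ AL; lia.
move=> _ /imsetP[B BL ->]; apply: leq_trans (rL _ BL).
rewrite -(card_imset _ (@setC_inj _)); apply: subset_leq_card.
apply/subsetP => _ /imsetP[_ /[1!inE] /andP[/imsetP[A AL ->] BA] ->].
by rewrite !inE setCK AL /=; move: BA; rewrite !properE !setCS.
Qed.

Lemma lubellID (R : realFieldType) n (F G : {set {set 'I_n}}) :
  G \subset F -> lubell R F = (lubell R G + lubell R (F :\: G))%R.
Proof. by move=> /setIidPr GF; rewrite /lubell (big_setID G) GF. Qed.

(** The minimal members form an antichain, of weight at most 1. Once they are removed, any chain of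
    remaining members can be extended downwards by a removed one, so the bound on chain lengths
    drops by one. *)
Lemma lubell_chain_free (R : realFieldType) n m j (G : {set {set 'I_n}}) :
    0 < m -> {in G, forall A : {set 'I_n}, m <= #|A|} ->
    (forall c : seq {set 'I_n}, sorted (fun A B : {set 'I_n} => A \proper B) c ->
       {subset c <= G} -> size c <= j) ->
  (lubell R G <= j%:R)%R.
Proof.
move=> m0; elim: j G => [|j IH] G mG chG.
  rewrite /lubell big1 // => A AG.
  have sub : {subset [:: A] <= G} by move=> B /[1!inE] /eqP ->.
  by have := chG [:: A] isT sub.
pose M := [set A in G | [forall B in G, ~~ (B \proper A)]].
have MG : M \subset G by apply/subsetP => A; rewrite inE => /andP[].
rewrite (lubellID _ MG) -natr1 addrC lerD //.
  apply: IH => [A|[//|A c] cs cG]; first by rewrite inE => /andP[_ /mG].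
  have /cG := mem_head A c; rewrite !inE => /andP[+ AG]; rewrite AG /=.
  rewrite negb_forall => /existsP[B]; rewrite negb_imply negbK => /andP[BG BA].
  have /= := chG [:: B, A & c]; rewrite BA => /(_ cs)/=; rewrite ltnS; apply.
  by move=> X; rewrite inE => /predU1P[-> //|/cG]; rewrite inE => /andP[].
(* The LYM inequality for the minimal members is the case [r = 0] of [lubell_few_below]. *)
rewrite -(@ler_pM2l R m%:R) ?ltr0n // mulr1 -[X in (X * _)%R]subr0.
apply: (@lubell_few_below R n m 0) => //.
  by move=> A /(subsetP MG)/mG.
move=> B; rewrite inE => /andP[_ /forallP MB].
rewrite leqn0 cards_eq0; apply/eqP/setP => A; rewrite !inE.
by apply/negP => /andP[/andP[AG _] AB]; move: (MB A); rewrite AG AB.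
Qed.

(** * Batons in families and the weight of a baton-free family *)

Lemma chain_nth_subset n (c : seq {set 'I_n}) i j :
  sorted (fun A B : {set 'I_n} => A \proper B) c ->
  i <= j -> j < size c -> nth set0 c i \subset nth set0 c j.
Proof.
move=> cs; rewrite leq_eqVlt => /predU1P[-> //|ij jc].
apply: proper_sub; apply: (sorted_ltn_nth _ set0 cs) => //.
  by move=> ? ? ?; exact: proper_trans.
exact: ltn_trans jc.
Qed.

(** The chain [c] carries the middle elements; the [a_i] are sent to members below its first set and
    the [b_j] to members above its last set, which has index [k - 3]. *)
Lemma contains_baton n (F : {set {set 'I_n}}) k s t (c : seq {set 'I_n}) :
    size c = k - 2 -> 2 < k ->
    sorted (fun A B : {set 'I_n} => A \proper B) c -> {subset c <= F} ->
    s <= #|[set A in F | A \proper nth set0 c 0]| ->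
    t <= #|[set A in F | nth set0 c (k - 3) \proper A]| ->
  contains (family_poset F) (baton k s t).
Proof.
move=> szc k2 cs cF; set D := [set A in F | _]; set U := [set A in F | _].
move=> sD tU.
pose g (x : baton k s t) : {set 'I_n} := match x with
  | inl (inl i) => nth set0 (enum D) i
  | inl (inr i) => nth set0 c i
  | inr j => nth set0 (enum U) j
  end.
have gD (i : 'I_s) : nth set0 (enum D) i \in D.
  by rewrite -mem_enum mem_nth // -cardE (leq_trans (ltn_ord i)).
have gU (i : 'I_t) : nth set0 (enum U) i \in U.
  by rewrite -mem_enum mem_nth // -cardE (leq_trans (ltn_ord i)).
have gF x : g x \in F.
  case: x => [[i|i]|j] /=.
  - by have := gD i; rewrite inE => /andP[].
  - by rewrite cF // mem_nth // szc.
  - by have := gU j; rewrite inE => /andP[].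
have cc i j : i <= j -> j < k - 2 -> nth set0 c i \subset nth set0 c j.
  by move=> ij jk; apply: chain_nth_subset; rewrite ?szc.
have Dc i : nth set0 (enum D) (i : 'I_s) \proper nth set0 c 0.
  by have := gD i; rewrite inE => /andP[].
have Uc i : nth set0 c (k - 3) \proper nth set0 (enum U) (i : 'I_t).
  by have := gU i; rewrite inE => /andP[].
have lD (i : 'I_s) : #|nth set0 (enum D) i| < #|nth set0 c 0|.
  exact: proper_card (Dc i).
have lU (i : 'I_t) : #|nth set0 c (k - 3)| < #|nth set0 (enum U) i|.
  exact: proper_card (Uc i).
have lDc (i : 'I_s) (j : 'I_(k - 2)) :
    #|nth set0 (enum D) i| < #|nth set0 c j|.
  by apply: leq_trans (lD i) _; rewrite subset_leq_card ?cc.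
have lcU (i : 'I_(k - 2)) (j : 'I_t) :
    #|nth set0 c i| < #|nth set0 (enum U) j|.
  apply: leq_ltn_trans (lU j); rewrite subset_leq_card ?cc //; last by lia.
  by have := ltn_ord i; lia.
have lDU (i : 'I_s) (j : 'I_t) :
    #|nth set0 (enum D) i| < #|nth set0 (enum U) j|.
  apply: ltn_trans (lD i) (leq_ltn_trans _ (lU j)).
  by rewrite subset_leq_card ?cc //; lia.
(* Elements of different layers have images of different sizes; within a layer the listed sets are
   distinct. *)
have g_inj : injective g.
  move=> [[i|i]|i] [[j|j]|j] /= gij.
  - congr (inl (inl _)); apply/val_inj/eqP.
    have := introT eqP gij; rewrite nth_uniq ?enum_uniq // -cardE.
      exact: leq_trans (ltn_ord i) sD.
    exact: leq_trans (ltn_ord j) sD.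
  - by have := lDc i j; rewrite gij ltnn.
  - by have := lDU i j; rewrite gij ltnn.
  - by have := lDc j i; rewrite gij ltnn.
  - congr (inl (inr _)); apply/val_inj/eqP.
    have := introT eqP gij; rewrite nth_uniq ?szc //.
    by apply: (sorted_uniq _ _ cs) => [? ? ?|?]; [exact: proper_trans|exact: properxx].
  - by have := lcU i j; rewrite gij ltnn.
  - by have := lDU j i; rewrite gij ltnn.
  - by have := lcU j i; rewrite gij ltnn.
  - congr inr; apply/val_inj/eqP.
    have := introT eqP gij; rewrite nth_uniq ?enum_uniq // -cardE.
      exact: leq_trans (ltn_ord i) tU.
    exact: leq_trans (ltn_ord j) tU.
have g_gen x y : baton_gen x y -> g x \subset g y.
  case: x y => [[i|i]|i] [[j|j]|j] //=.
  - by move=> /eqP ->; exact: proper_sub.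
  - by move=> /eqP ji; rewrite cc // ji.
  - by move=> /eqP ik; rewrite (_ : nat_of_ord i = k - 3) ?proper_sub //; lia.
apply/containsP; exists (fun x => exist _ (g x) (gF x) : family_poset F); split.
  by move=> x y /(congr1 val)/g_inj.
move=> x y; rewrite le_batonE le_family_posetE /= => /connectP[p + ->].
elim: p x => [|z p IH] x //= /andP[/g_gen xz /IH]; exact: subset_trans.
Qed.

Lemma lubell_baton_free (R : realFieldType) n m k s t (F F0 : {set {set 'I_n}}) :
    2 < k -> 0 < s -> 0 < t -> s + t < m ->
    poset_free (baton k s t) F -> F0 \subset F ->
    {in F0, forall A : {set 'I_n}, m <= #|A|} ->
    {in F0, forall A : {set 'I_n}, #|A| + m <= n} ->
  (lubell R F0 <= k%:R - 1 + (s%:R - 1) / (m%:R - (s%:R - 1))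
                  + (t%:R - 1) / (m%:R - (t%:R - 1)))%R.
Proof.
move=> k2 s0 t0 stm freeF /subsetP F0F lo hi.
have m0 : 0 < m by lia.
pose D (B : {set 'I_n}) := #|[set A in F0 | A \proper B]|.
pose U (B : {set 'I_n}) := #|[set A in F0 | B \proper A]|.
pose L := [set B in F0 | D B < s].
pose H := [set B in F0 :\: L | U B < t].
have LF0 : L \subset F0 by apply/subsetP => A; rewrite inE => /andP[].
have HF0L : H \subset F0 :\: L by apply/subsetP => A; rewrite inE => /andP[].
have HF0 := subset_trans HF0L (subsetDl _ _).
rewrite (lubellID R LF0) (lubellID R HF0L).
(* With at most [r - 1] neighbours the bound is [m / (m - (r - 1))], which equals
   [1 + (r - 1) / (m - (r - 1))]. *)
have aux r (x : R) : 0 < r -> r < m -> ((m%:R - (r.-1)%:R) * x <= m%:R)%R ->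
    (x <= 1 + (r%:R - 1) / (m%:R - (r%:R - 1)))%R.
  case: r => // r _ rm; rewrite -natr1 addrK /= => h.
  have d0 : (0 < m%:R - r%:R :> R)%R by rewrite subr_gt0 ltr_nat; lia.
  rewrite -(ler_pM2l d0) mulrDr mulr1 [X in (_ <= _ + X)%R]mulrC divfK ?gt_eqF //.
  by rewrite subrK.
have hL : (lubell R L <= 1 + (s%:R - 1) / (m%:R - (s%:R - 1)))%R.
  apply: aux => //; first by lia.
  apply: lubell_few_below => // [A /(subsetP LF0)/lo //|B].
  rewrite inE => /andP[_ lB]; rewrite -ltnS prednK //; apply: leq_trans lB.
  rewrite ltnS; apply: subset_leq_card; apply/subsetP => A.
  by rewrite !inE => /andP[/andP[-> _] ->].
have hH : (lubell R H <= 1 + (t%:R - 1) / (m%:R - (t%:R - 1)))%R.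
  apply: aux => //; first by lia.
  apply: lubell_few_above => // [A /(subsetP HF0)/hi //|B].
  rewrite inE => /andP[_ lB]; rewrite -ltnS prednK //; apply: leq_trans lB.
  rewrite ltnS; apply: subset_leq_card; apply/subsetP => A.
  by rewrite inE => /andP[/(subsetP HF0) AF0 BA]; rewrite inE AF0.
(* A chain of [k - 2] sets here would have at least [s] members below its bottom and [t] above its
   top, giving a baton. The three parts thus contribute the constant [1 + 1 + (k - 3)]. *)
have hM : (lubell R ((F0 :\: L) :\: H) <= (k - 3)%:R)%R.
  apply: (@lubell_chain_free R n m) => // [A|c cs cG].
    by rewrite !inE => /and3P[_ _ /lo].
  rewrite leqNgt; apply: contra freeF => szc.
  have {}cG A : A \in c -> [/\ A \in F0, s <= D A & t <= U A].
    move=> /cG; rewrite !inE => /andP[+ /andP[+ AF0]].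
    by rewrite AF0 /= => + sA; rewrite sA /= -leqNgt; rewrite -leqNgt in sA.
  have szt : size (take (k - 2) c) = k - 2 by rewrite size_takel //; lia.
  have DF B : D B <= #|[set A in F | A \proper B]|.
    by apply: subset_leq_card; apply/subsetP => A; rewrite !inE => /andP[/F0F -> ->].
  have UF B : U B <= #|[set A in F | B \proper A]|.
    by apply: subset_leq_card; apply/subsetP => A; rewrite !inE => /andP[/F0F -> ->].
  apply: (contains_baton szt) => //.
  - exact: take_sorted.
  - by move=> A /mem_take/cG[/F0F].
  - apply: leq_trans (DF _); have [] // := cG (nth set0 (take (k - 2) c) 0).
    by apply: (@mem_take (k - 2)); rewrite mem_nth // szt; lia.
  - apply: leq_trans (UF _); have [] // := cG (nth set0 (take (k - 2) c) (k - 3)).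
    by apply: (@mem_take (k - 2)); rewrite mem_nth // szt; lia.
have -> : (k%:R = (k - 3)%:R + 3 :> R)%R by rewrite -natrD subnK.
by lra.
Qed.

(** * Estimates for binomial coefficients *)

Lemma leq_binS n i : i.*2 < n -> 'C(n, i) <= 'C(n, i.+1).
Proof.
move=> i2n; rewrite -(leq_pmul2l (ltn0Sn i)) mul_bin_left leq_mul2r.
by apply/orP; right; lia.
Qed.

(** The hypotheses say that [j] is at least as close to [n / 2] as [i]. If [j] lies past the middle,
    it is reflected to [n - j], which is still at least [i]. *)
Lemma leq_bin_sym n i j : i <= j -> i + j <= n -> 'C(n, i) <= 'C(n, j).
Proof.
have mono j' : i <= j' -> j'.*2 <= n -> 'C(n, i) <= 'C(n, j').
  elim: j' => [|j' IH]; first by rewrite leqn0 => /eqP ->.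
  rewrite leq_eqVlt => /predU1P[-> //|ij] j2n.
  by apply: leq_trans (IH _ _) (leq_binS _); lia.
move=> ij ijn; have [|nj] := leqP j.*2 n; first exact: mono.
by rewrite -[leqRHS]bin_sub; [apply: mono|]; lia.
Qed.

Lemma leq_bin_half n i : 'C(n, i) <= 'C(n, n %/ 2).
Proof.
have [ni|i_n] := ltnP n i; first by rewrite bin_small.
have [ih|hi] := leqP i (n %/ 2); first by apply: leq_bin_sym; lia.
by rewrite -bin_sub //; apply: leq_bin_sym; lia.
Qed.

(** The ratio ['C(n, i.+1) / 'C(n, i) = (n - i) / (i + 1)] is at least 2 as long as
    [3 * i.+1 <= n]. *)
Lemma leq_exp2_bin n m d : 3 * (m + d) <= n -> 2 ^ d * 'C(n, m) <= 'C(n, m + d).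
Proof.
elim: d => [|d IH] mdn; first by rewrite mul1n addn0.
have {}IH : 2 ^ d * 'C(n, m) <= 'C(n, m + d) by apply: IH; lia.
rewrite expnS -mulnA addnS.
apply: (@leq_trans (2 * 'C(n, m + d))); first by rewrite leq_mul2l IH.
rewrite -(leq_pmul2l (ltn0Sn (m + d))) mul_bin_left mulnA leq_mul2r.
by apply/orP; right; lia.
Qed.

Lemma cube_leq_exp2 c : 0 < c -> exists N, forall n, N <= n -> n ^ 3 <= 2 ^ (n %/ c).
Proof.
(* The threshold gives [(4 * c) ^ 3 <= j], so that [n ^ 3 <= (4 * c) ^ 3 * j.+1 ^ 3 <= j.+1 ^ 4 <= 2
   ^ (4 * j)]. *)
move=> c0; exists ((4 * c) ^ 4) => n Nn; set j := n %/ (4 * c).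
have c40 : 0 < 4 * c by rewrite muln_gt0.
have nj : n <= 4 * c * j.+1 by rewrite mulnC ltnW // ltn_ceil.
have cj : (4 * c) ^ 3 <= j.+1.
  by apply: leqW; rewrite leq_divRL // mulnC -expnS.
apply: (@leq_trans (j.+1 ^ 4)).
  apply: leq_trans (_ : (4 * c) ^ 3 * j.+1 ^ 3 <= _).
    by rewrite -expnMn leq_exp2r.
  by rewrite expnS leq_mul2r cj orbT.
apply: (@leq_trans ((2 ^ j) ^ 4)); first by rewrite leq_exp2r // ltn_expl.
rewrite -expnM leq_exp2l // leq_divRL //.
by apply: leq_trans (leq_divM n (4 * c)); rewrite -/j; lia.
Qed.

(** * From weights to sizes, level by level *)

Lemma sum_levels (V : nmodType) n (f : nat -> V) a b :
  (\sum_(A : {set 'I_n} | (a <= #|A| < b)%N) f #|A| =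
   \sum_(a <= i < b) f i *+ 'C(n, i))%R.
Proof.
under [RHS]eq_bigr => i _.
  rewrite -[n in 'C(n, i)]card_ord -cardsT -cards_draws -sumr_const.
  under eq_bigl => A do rewrite inE subsetT /=.
  over.
rewrite (exchange_big_dep predT) //= [LHS]big_mkcond; apply: eq_bigr => A _.
under [RHS]eq_bigl => i do rewrite eq_sym.
by rewrite big_nat1_eq.
Qed.

Lemma leq_sum_bin n a b x :
    (forall i, a <= i < b -> i <= n -> 'C(n, i) <= x) ->
  \sum_(a <= i < b) 'C(n, i) <= (b - a) * x.
Proof.
move=> h; rewrite -sum_nat_const_nat big_nat [leqRHS]big_nat.
apply: leq_sum => i abi; have [|ni] := leqP i n; first exact: h.
by rewrite bin_small.
Qed.

Lemma card_levels n a b :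
  #|[set A : {set 'I_n} | a <= #|A| < b]| = \sum_(a <= i < b) 'C(n, i).
Proof.
rewrite -sum1_card (eq_bigl (fun A : {set 'I_n} => a <= #|A| < b)); last first.
  by move=> A; rewrite inE.
have /= -> := @sum_levels _ n (fun=> 1) a b.
by apply: eq_bigr => i _; rewrite natn.
Qed.

(** The [m] lowest and the [m] highest levels are discarded, each having at most ['C(n, m)] sets. *)
Lemma leq_card_trim n m (F : {set {set 'I_n}}) : m.*2 <= n ->
  #|F| <= #|[set A in F | m <= #|A| & #|A| + m <= n]| + m.*2 * 'C(n, m).
Proof.
move=> mn.
have lo : #|[set A : {set 'I_n} | 0 <= #|A| < m]| <= m * 'C(n, m).
  rewrite card_levels -[m in leqRHS]subn0; apply: leq_sum_bin => i im _.
  by apply: leq_bin_sym; lia.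
have hi : #|[set A : {set 'I_n} | (n - m).+1 <= #|A| < n.+1]| <= m * 'C(n, m).
  rewrite card_levels [m in leqRHS](_ : m = n.+1 - (n - m).+1); last by lia.
  apply: leq_sum_bin => i im ni; rewrite -bin_sub //.
  by apply: leq_bin_sym; lia.
set F0 := [set A in F | _]; rewrite -addnn mulnDl.
apply: leq_trans (leq_add (leqnn #|F0|) (leq_add lo hi)).
apply: leq_trans (leq_add (leqnn _) (leq_card_setU _ _)).
apply: leq_trans (leq_card_setU _ _); apply: subset_leq_card.
apply/subsetP => A AF; rewrite !inE AF /=.
by move: #|A| (leq_card_ord A) => a; lia.
Qed.

(* Writing x_i for the fraction of level i lying in F, the size of F is
   \sum_i ('C(n, i) - T) x_i + T * lubell F, and T separates the levels where
   'C(n, i) - T is nonnegative from those where it is nonpositive. *)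
Lemma card_leq_lubell (R : realFieldType) n (F : {set {set 'I_n}}) T p q :
    q <= n.+1 ->
    (forall i, p <= i < q -> T <= 'C(n, i)) ->
    (forall i, i <= n -> ~~ (p <= i < q) -> 'C(n, i) <= T) ->
  (#|F|%:R <= \sum_(p <= i < q) ('C(n, i)%:R - T%:R) + T%:R * lubell R F)%R.
Proof.
move=> qn hin hout.
pose w i : R := (('C(n, i)%:R - T%:R) / 'C(n, i)%:R)%R.
have C0 i : i <= n -> ('C(n, i)%:R != 0 :> R)%R.
  by move=> ni; rewrite pnatr_eq0 -lt0n bin_gt0.
have -> : (\sum_(p <= i < q) ('C(n, i)%:R - T%:R) =
          \sum_(A : {set 'I_n} | (p <= #|A| < q)%N) w #|A|)%R.
  rewrite sum_levels big_nat [RHS]big_nat; apply: eq_bigr => i pq.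
  by rewrite -[RHS]mulr_natr /w divfK // C0; lia.
have -> : (#|F|%:R = \sum_(A in F) w #|A| + T%:R * lubell R F)%R.
  rewrite -sum1_card natr_sum /lubell mulr_sumr -big_split /=.
  apply: eq_bigr => A _; have := C0 _ (leq_card_ord A); rewrite /w => ?.
  by field.
(* Termwise comparison: members of [F] outside the window contribute at most 0, and sets of the
   window missing from [F] would contribute at least 0. *)
rewrite lerD2r big_mkcond [leRHS]big_mkcond; apply: ler_sum => A _.
have Cpos : (0 <= 'C(n, #|A|)%:R^-1 :> R)%R by rewrite invr_ge0.
case: ifP => AF; case: ifP => pq //.
  apply: mulr_le0_ge0 => //; rewrite subr_le0 ler_nat.
  by rewrite hout ?pq ?leq_card_ord.
by apply: mulr_ge0 => //; rewrite subr_ge0 ler_nat hin.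
Qed.

(** * The upper bound for [La] *)

Lemma La_natr_le (R : realFieldType) (d : Order.disp_t) (H : finPOrderType d)
    n (x : R) :
  (0 <= x)%R ->
  (forall F : {set {set 'I_n}}, poset_free H F -> #|F|%:R <= x)%R ->
  ((La n H)%:R <= x)%R.
Proof.
move=> x0 h; rewrite /La; elim/big_ind: _ => // a b ax bx.
by rewrite /maxn; case: ifP.
Qed.

(** The window consists of the [k - 1] middle levels, and [(n + k) %/ 2] is the first level above
    it. Its binomial coefficient is therefore the threshold [T] separating the window from the other
    levels. *)
Lemma mid_levels_bin n k i : 2 < k -> k <= n ->
  (n - (k - 2)) %/ 2 <= i < ((n + (k - 2)) %/ 2).+1 ->
  'C(n, (n + k) %/ 2) <= 'C(n, i).
Proof.
move=> k2 kn ir; rewrite -bin_sub; last by lia.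
by apply: leq_bin_sym; lia.
Qed.

Lemma outer_levels_bin n k i : 2 < k -> k <= n -> i <= n ->
  ~~ ((n - (k - 2)) %/ 2 <= i < ((n + (k - 2)) %/ 2).+1) ->
  'C(n, i) <= 'C(n, (n + k) %/ 2).
Proof.
move=> k2 kn i_n ir; have [ik|ik] := leqP ((n + k) %/ 2) i.
  by rewrite -bin_sub //; apply: leq_bin_sym; lia.
by apply: leq_bin_sym; lia.
Qed.

(** The term in [1 / n] comes from the excess weight of the sets with few members below or above;
    the term [1 / n ^ 2] pays for the sets discarded by trimming. *)
Lemma La_baton_le (R : realFieldType) k s t : 2 < k -> 0 < s -> 0 < t ->
  exists N, forall n, N <= n ->
    ((La n (baton k s t))%:R <=
     \sum_((n - (k - 2)) %/ 2 <= i < ((n + (k - 2)) %/ 2).+1) ('C(n, i))%:R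
     + ('C(n, (n + k) %/ 2))%:R
       * (2 * k%:R * (s%:R + t%:R - 2) / n%:R + (n%:R ^+ 2)^-1) :> R)%R.
Proof.
(* The constant 12 comes from [1 / 3 - 1 / 4]: binomial coefficients at least double at each of the
   [n %/ 12] steps up from level [n %/ 4]. *)
move=> k2 s0 t0; have [N0 hN0] := cube_leq_exp2 (isT : 0 < 12).
exists (N0 + 20 * (k + s + t)) => n Nn; set m := n %/ 4.
have n0 : (0 < n%:R :> R)%R by rewrite ltr0n; lia.
have st0 : (0 <= s%:R + t%:R - 2 :> R)%R.
  by rewrite subr_ge0 -natrD ler_nat; lia.
set p := (n - (k - 2)) %/ 2; set q := ((n + (k - 2)) %/ 2).+1.
set T := 'C(n, (n + k) %/ 2).
apply: La_natr_le => [|F freeF].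
  apply: addr_ge0; first by apply: sumr_ge0.
  apply: mulr_ge0 => //; apply: addr_ge0; last by rewrite invr_ge0 exprn_ge0 ?ltW.
  by rewrite divr_ge0 ?mulr_ge0 // ltW.
have := leq_card_trim F (_ : m.*2 <= n) => /(_ ltac:(lia)).
set F0 := [set A in F | _] => trim.
have tail : ((m.*2 * 'C(n, m))%:R <= T%:R * (n%:R ^+ 2)^-1 :> R)%R.
  rewrite ler_pdivlMr ?exprn_gt0 // -natrX -natrM ler_nat.
  apply: (@leq_trans (n ^ 3 * 'C(n, m))).
    rewrite mulnAC leq_mul2r expnS leq_mul2r; apply/orP; right; apply/orP; right.
    by rewrite /m; lia.
  apply: (@leq_trans (2 ^ (n %/ 12) * 'C(n, m))).
    by rewrite leq_mul2r hN0 ?orbT //; lia.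
  apply: leq_trans (leq_exp2_bin _) _; first by rewrite /m; lia.
  by apply: leq_bin_sym; rewrite /m; lia.
have lub := @lubell_baton_free R n m k s t F F0 k2 s0 t0.
have {lub} lub : (lubell R F0 <= k%:R - 1 + (s%:R - 1) / (m%:R - (s%:R - 1))
                  + (t%:R - 1) / (m%:R - (t%:R - 1)))%R.
  apply: lub => //; first by rewrite /m; lia.
  - by apply/subsetP => A; rewrite inE => /andP[].
  - by move=> A; rewrite inE => /and3P[].
  - by move=> A; rewrite inE => /and3P[].
(* Since [m] is about [n / 4], the denominator is at least [n / 6], and [6 <= 2 * k]. *)
have frac r : 0 < r <= s + t ->
    ((r%:R - 1) / (m%:R - (r%:R - 1)) <= 2 * k%:R * (r%:R - 1) / n%:R :> R)%R.
  case: r => // r rst; rewrite -natr1 addrK.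
  have d0 : (0 < m%:R - r%:R :> R)%R.
    by rewrite subr_gt0 ltr_nat /m; lia.
  rewrite mulrAC [leRHS]mulrC ler_wpM2l // ler_pdivlMr // ler_pdivrMl //.
  rewrite -natrM -natrB; last by rewrite /m; lia.
  rewrite -natrM ler_nat.
  apply: (@leq_trans ((m - r) * 6)); first by rewrite /m; lia.
  by rewrite leq_mul2l; apply/orP; right; lia.
have size0 := @card_leq_lubell R n F0 T p q.
have {size0} size0 :
    (#|F0|%:R <= \sum_(p <= i < q) 'C(n, i)%:R - T%:R * (k%:R - 1)
                 + T%:R * lubell R F0 :> R)%R.
  apply: le_trans (size0 _ _ _) _; first by rewrite /q; lia.
  - by move=> i; apply: mid_levels_bin => //; lia.
  - by move=> i; apply: outer_levels_bin => //; lia.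
  rewrite lerD2r sumrB sumr_const_nat (_ : q - p = k - 1); last first.
    by rewrite /p /q; lia.
  by rewrite -[X in (_ - X <= _)%R]mulr_natr natrB //; lia.
have fs := frac s ltac:(lia); have ft := frac t ltac:(lia).
have {}trim : (#|F|%:R <= #|F0|%:R + (m.*2 * 'C(n, m))%:R :> R)%R.
  by rewrite -natrD ler_nat.
apply: (le_trans trim); apply: (le_trans (lerD size0 tail)).
rewrite [X in (_ <= _ + X)%R]mulrDr addrA lerD2r -addrA lerD2l addrC -mulrBr.
rewrite ler_wpM2l //.
have -> : (2 * k%:R * (s%:R + t%:R - 2) / n%:R =
  2 * k%:R * (s%:R - 1) / n%:R + 2 * k%:R * (t%:R - 1) / n%:R :> R)%R by ring.
by move: lub fs ft; lra.
Qed.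

(** * The lower bound from the middle levels *)

(** A baton contains a chain of [k] elements, whose images have strictly increasing sizes, but only
    [k - 1] sizes occur. *)
Lemma mid_levels_baton_free n k s t : 2 < k -> 0 < s -> 0 < t -> k <= n ->
  poset_free (baton k s t)
    [set A : {set 'I_n} | (n - (k - 2)) %/ 2 <= #|A| < ((n + (k - 2)) %/ 2).+1].
Proof.
move=> k2 s0 t0 kn; set G := [set A | _].
apply/negP => /containsP[f [f_inj f_le]].
pose a : baton k s t := inl (inl (Ordinal s0)).
pose b : baton k s t := inr (Ordinal t0).
have lt_gen x y : baton_gen x y -> #|val (f x)| < #|val (f y)|.
  move=> xy; have /f_le : (x <= y)%O by rewrite le_batonE connect1.
  rewrite le_family_posetE => fxy; apply: proper_card; rewrite properEneq fxy andbT.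
  apply/eqP => /val_inj/f_inj exy; have := baton_gen_rank xy.
  by rewrite exy ltnn.
have c_ge i (ik : i < k - 2) :
    #|val (f a)| + i < #|val (f (inl (inr (Ordinal ik))))|.
  elim: i ik => [|i IH] ik; first by rewrite addn0; apply: lt_gen.
  rewrite addnS; apply: leq_ltn_trans (IH (ltnW ik)) _.
  by apply: lt_gen => /=.
have k3 : k - 3 < k - 2 by lia.
have cb : #|val (f (inl (inr (Ordinal k3))))| < #|val (f b)|.
  by apply: lt_gen => /=; apply/eqP; lia.
have := valP (f a); have := valP (f b); rewrite !inE.
move: (c_ge _ k3) cb.
set x := #|_|; set y := #|_|; set z := #|_|.
by lia.
Qed.

Lemma leq_La_baton n k s t : 2 < k -> 0 < s -> 0 < t -> k <= n ->
  \sum_((n - (k - 2)) %/ 2 <= i < ((n + (k - 2)) %/ 2).+1) 'C(n, i)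
    <= La n (baton k s t).
Proof.
move=> k2 s0 t0 kn; rewrite -card_levels /La.
exact: leq_bigmax_cond (mid_levels_baton_free k2 s0 t0 kn).
Qed.

(** * Explicit two-sided bounds for the ratio *)

(** With [h = n %/ 2], passing from level [h + d] to the next loses at most [(2 * d + 1) / h] times
    the middle coefficient, and the first [d] odd numbers sum to [d ^ 2]. *)
Lemma leq_bin_mid n d : n %/ 2 + d <= n ->
  n %/ 2 * 'C(n, n %/ 2) <= n %/ 2 * 'C(n, n %/ 2 + d) + d ^ 2 * 'C(n, n %/ 2).
Proof.
set h := n %/ 2; elim: d => [|d IH] hdn; first by rewrite addn0 addn0.
have {}IH := IH (ltac:(lia)).
have le : 'C(n, h + d) <= 'C(n, h) := leq_bin_half _ _.
have step : h * 'C(n, h + d) <= h * 'C(n, h + d.+1) + d.*2.+1 * 'C(n, h + d).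
  have := mul_bin_left n (h + d); rewrite addnS.
  set x := 'C(n, h + d); set y := 'C(n, _) => xy.
  have hn : h <= n - h by rewrite /h; lia.
  by nia.
apply: leq_trans IH _; rewrite (_ : d.+1 ^ 2 = d.*2.+1 + d ^ 2); last by lia.
rewrite mulnDl addnA leq_add2r; apply: leq_trans step _.
by rewrite leq_add2l leq_mul2l le orbT.
Qed.

Lemma La_baton_ratio_le (R : realFieldType) k s t : 2 < k -> 0 < s -> 0 < t ->
  exists N, forall n, N <= n ->
    ((La n (baton k s t))%:R / 'C(n, n %/ 2)%:R <=
     k%:R - 1 + (2 * k%:R * (s%:R + t%:R - 2) + 1) / n%:R :> R)%R.
Proof.
move=> k2 s0 t0; have [N hN] := La_baton_le R k2 s0 t0.
exists (N + k) => n Nn; have {hN} := hN n ltac:(lia).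
set p := (n - (k - 2)) %/ 2; set q := ((n + (k - 2)) %/ 2).+1.
set C := 'C(n, n %/ 2); set T := 'C(n, (n + k) %/ 2) => h.
have n1 : (1 <= n%:R :> R)%R by rewrite ler1n; lia.
have n0 := lt_le_trans ltr01 n1.
have st0 : (0 <= s%:R + t%:R - 2 :> R)%R.
  by rewrite subr_ge0 -natrD ler_nat; lia.
have C0 : (0 < C%:R :> R)%R by rewrite ltr0n bin_gt0; lia.
rewrite ler_pdivrMr //; apply: (le_trans h); rewrite [leRHS]mulrDl lerD //.
  rewrite -natr_sum mulrC (_ : k%:R - 1 = (k - 1)%:R)%R; last by rewrite natrB //; lia.
  rewrite -natrM ler_nat mulnC (_ : k - 1 = q - p); last by rewrite /p /q; lia.
  by apply: leq_sum_bin => i _ _; apply: leq_bin_half.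
rewrite mulrC; apply: ler_pM => //.
- by rewrite addr_ge0 ?invr_ge0 ?exprn_ge0 ?divr_ge0 ?mulr_ge0 // ltW.
- by rewrite [leRHS]mulrDl lerD2l mul1r lef_pV2 ?posrE ?exprn_gt0 // expr2 ler_peMl // ltW.
- by rewrite ler_nat leq_bin_half.
Qed.

Lemma La_baton_ratio_ge (R : realFieldType) n k s t :
    2 < k -> 0 < s -> 0 < t -> k <= n ->
  (k%:R - 1 - 3 * k%:R ^+ 3 / n%:R <=
     (La n (baton k s t))%:R / 'C(n, n %/ 2)%:R :> R)%R.
Proof.
move=> k2 s0 t0 kn; have := leq_La_baton k2 s0 t0 kn.
set p := (n - (k - 2)) %/ 2; set q := ((n + (k - 2)) %/ 2).+1 => Lale.
set C := 'C(n, n %/ 2); pose T := 'C(n, (n + k) %/ 2).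
have n0 : (0 < n%:R :> R)%R by rewrite ltr0n; lia.
have C0 : (0 < C%:R :> R)%R by rewrite ltr0n bin_gt0; lia.
have TLa : (k - 1) * T <= La n (baton k s t).
  apply: leq_trans Lale; rewrite (_ : k - 1 = q - p); last by rewrite /p /q; lia.
  rewrite -sum_nat_const_nat big_nat [leqRHS]big_nat.
  by apply: leq_sum => i /mid_levels_bin; apply.
(* Here [leq_bin_mid] is used with a distance of at most [k]; the factor 3 comes from
   [n <= 3 * (n %/ 2)]. *)
have CT : n * C <= n * T + 3 * k ^ 2 * C.
  have := @leq_bin_mid n ((n + k) %/ 2 - n %/ 2).
  rewrite subnKC; last by lia.
  move=> /(_ ltac:(lia)); rewrite -/C -/T => CT.
  have dk : ((n + k) %/ 2 - n %/ 2) ^ 2 <= k ^ 2 by rewrite leq_exp2r //; lia.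
  have h3 : n <= 3 * (n %/ 2) by lia.
  have TC : T <= C := leq_bin_half _ _.
  by move: (n %/ 2) (_ ^ 2) CT dk h3 => h d CT dk h3; nia.
rewrite ler_pdivlMr //.
apply: (@le_trans _ _ ((k - 1) * T)%:R%R); last by rewrite ler_nat.
rewrite -(ler_pM2l n0) mulrA mulrBr [X in (_ - X)%R]mulrC divfK ?gt_eqF //.
rewrite natrM natrB; last by lia.
move: CT; rewrite -(ler_nat R) natrD !natrM => CT.
have k1 : (0 <= k%:R - 1 :> R)%R by rewrite subr_ge0 ler1n; lia.
(* The loss [(k - 1) * 3 * k ^ 2] is rounded up to [3 * k ^ 3]. *)
by have := ler_wpM2l k1 CT; have := mulr_ge0 (exprn_ge0 2 (ler0n R k)) (ltW C0); lra.
Qed.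

(* Passage to the limit *)
From mathcomp Require Import all_classical all_reals all_analysis.

Import numFieldNormedType.Exports.
Local Open Scope classical_set_scope.
Local Open Scope ring_scope.

(** The exponent is raised from -2 to -3/2, and [n >= e] makes the square root of the logarithm at
    least 1. *)
Lemma invn_sqr_le_error (R : realType) (n : nat) :
  expR 1 <= n%:R :> R ->
  (n%:R ^+ 2)^-1 <= n%:R `^ (- (3 / 2)) * Num.sqrt (ln n%:R) :> R.
Proof.
move=> en; have n0 : 0 < n%:R :> R := lt_le_trans (expR_gt0 1) en.
have n1 : 1 <= n%:R :> R by rewrite ler1n -(ltr0n R).
rewrite -[leLHS]mulr1; apply: ler_pM => //.
  rewrite -powR_invn; last exact: ltW.
  by apply: ler_powR => //; lra.
rewrite -[leLHS]sqrtr1 ler_sqrt; last exact: ln_ge0.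
by rewrite -[leLHS]expRK ler_ln ?posrE ?expR_gt0.
Qed.

Lemma cvg_addM_invn (R : realType) (a c : R) : a + c / n%:R @[n --> \oo] --> a.
Proof.
rewrite -[X in _ --> X]addr0; apply: cvgD; first exact: cvg_cst.
rewrite -[X in _ --> X](mulr0 c); apply: cvgM; first exact: cvg_cst.
apply/gtr0_cvgV0; last exact: cvgr_idn.
by near=> n; rewrite ltr0n; near: n; exact: nbhs_infty_gt.
Unshelve. all: by end_near. Qed.

Theorem theorem1 (R : realType) (k s t : nat)
    (hk : (3 <= k)%N) (hs : (1 <= s)%N) (ht : (1 <= t)%N) :
  (exists e : nat -> R,
      e =O_\oo (fun n : nat => n%:R `^ (- (3 / 2)) * Num.sqrt (ln n%:R) : R)
   /\ \forall n \near \oo,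
        (La n (baton k s t))%:R <=
          \sum_((n - (k - 2)) %/ 2 <= i < ((n + (k - 2)) %/ 2).+1) ('C(n, i))%:R
          + ('C(n, (n + k) %/ 2))%:R
            * (2 * k%:R * (s%:R + t%:R - 2) / n%:R + e n))
  /\ (fun n : nat => (La n (baton k s t))%:R / ('C(n, n %/ 2))%:R : R)
       @ \oo --> (k%:R - 1 : R).
Proof.
split.
  (* The comparison function itself serves as the error, since it eventually dominates
     [1 / n ^ 2]. *)
  exists (fun n : nat => n%:R `^ (- (3 / 2)) * Num.sqrt (ln n%:R) : R).
  split; first exact: idO.
  have [N hN] := La_baton_le R hk hs ht.
  near=> n.
  have /hN/le_trans : (N <= n)%N by near: n; exact: nbhs_infty_ge.
  apply; rewrite lerD2l ler_wpM2l // lerD2l; apply: invn_sqr_le_error.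
  by near: n; exact: nbhs_infty_ger.
have [N hN] := La_baton_ratio_le R hk hs ht.
apply: (@squeeze_cvgr _ _ _ R
  (fun n => k%:R - 1 + - (3 * k%:R ^+ 3) / n%:R)
  (fun n => k%:R - 1 + (2 * k%:R * (s%:R + t%:R - 2) + 1) / n%:R));
  [|exact: cvg_addM_invn|exact: cvg_addM_invn].
near=> n; apply/andP; split.
  rewrite mulNr; apply: La_baton_ratio_ge => //.
  by near: n; exact: nbhs_infty_ge.
by apply: hN; near: n; exact: nbhs_infty_ge.
Unshelve. all: by end_near. Qed.
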